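(* Let $H$ be a separable infinite-dimensional complex Hilbert space, let $D \subset H\setminus\{0\}$ be a countable dense subset of $H$, and let $R>1$. Let $B_R=\{T\in L(H): \|T\|\le R\}$. Then the set $L_{HC}(D)$ of operators $T\in B_R$ for which every $x\in D$ is a hypercyclic vector is a dense $G_\delta$ subset of $B_R$, where $B_R$ carries the (relative) strong operator topology.
   Context: $L(H)$ denotes the bounded linear operators on $H$. For $T\in L(H)$, a vector $x\in H$ is hypercyclic for $T$ if the orbit $\{x,Tx,T^2x,\dots\}$ is norm-dense in $H$. *)

(* Defs.v *)
From HB Require Import structures.
From mathcomp Require Import all_boot all_order all_algebra.
From mathcomp Require Import all_classical all_reals all_analysis.
From mathcomp Require Import complex.
Import Order.TTheory GRing.Theory Num.Theory.
Import numFieldNormedType.Exports.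
Set Implicit Arguments. Unset Strict Implicit. Unset Printing Implicit Defensive.
Local Open Scope ring_scope.
Local Open Scope classical_set_scope.

(* A complex inner product compatible with the norm of H: linear in the first
   argument, conjugate symmetric, and <x,x> = ||x||^2.  Together with
   completeness of H this makes H a complex Hilbert space. *)
Definition is_inner_product (R : realType) (H : normedModType R[i])
    (ip : H -> H -> R[i]) : Prop :=
  [/\ forall (a : R[i]) (x y z : H), ip (a *: x + y) z = a * ip x z + ip y z,
      forall x y : H, ip x y = conjc (ip y x)
    & forall x : H, ip x x = `|x| ^+ 2].

Definition separable (T : topologicalType) : Prop :=
  exists S : set T, countable S /\ dense S.

Definition infinite_dimensional (R : realType) (H : normedModType R[i]) : Prop :=
  forall (n : nat) (v : 'I_n -> H),
    exists x : H, forall c : 'I_n -> R[i], x <> \sum_(i < n) c i *: v i.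

Definition is_linear_op (R : realType) (H : normedModType R[i]) (T : H -> H) : Prop :=
  forall (a : R[i]) (x y : H), T (a *: x + y) = a *: T x + T y.

(* B_r = { T in L(H) : ||T|| <= r }, with ||T|| <= r unfolded as
   ||T x|| <= r ||x|| for all x (this also gives boundedness). *)
Definition ball_ops (R : realType) (H : normedModType R[i]) (r : R) : set (H -> H) :=
  [set T | is_linear_op T /\ forall x : H, `|T x| <= (r%:C)%C * `|x|].

Definition hypercyclic_vector (T' : topologicalType) (T : T' -> T') (x : T') : Prop :=
  dense (range (fun n : nat => iter n T x)).

Definition L_HC (R : realType) (H : normedModType R[i]) (r : R) (D : set H)
  : set (H -> H) :=
  [set T | ball_ops r T /\ forall x, D x -> hypercyclic_vector T x].

Definition sot_open_in (R : realType) (H : normedModType R[i])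
    (B U : set (H -> H)) : Prop :=
  U `<=` B /\
  forall T, U T -> exists (n : nat) (xs : 'I_n -> H) (e : R), 0 < e /\
    forall S, B S -> (forall i : 'I_n, `|S (xs i) - T (xs i)| < (e%:C)%C) -> U S.

Definition sot_Gdelta_in (R : realType) (H : normedModType R[i])
    (B A : set (H -> H)) : Prop :=
  exists U : nat -> set (H -> H),
    (forall k, sot_open_in B (U k)) /\ A = \bigcap_k U k.

Definition sot_dense_in (R : realType) (H : normedModType R[i])
    (B A : set (H -> H)) : Prop :=
  A `<=` B /\
  forall U, sot_open_in B U -> U !=set0 -> (U `&` A) !=set0.

(* Main.v *)
Require Import Defs.
From HB Require Import structures.
From mathcomp Require Import all_boot all_order all_algebra.
From mathcomp Require Import all_classical all_reals all_analysis.
From mathcomp Require Import complex.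
From mathcomp Require Import ring lra.
Import Order.TTheory GRing.Theory Num.Theory.
Import numFieldNormedType.Exports.
Local Open Scope ring_scope.
Local Open Scope classical_set_scope.
Set Implicit Arguments.
Unset Strict Implicit.
Unset Printing Implicit Defensive.

(** For [x <> 0], the operators of the ball that bring some iterate of [x]
    within [e] of [y] form an open set; letting [x], [y] run through [D] and
    [e] through [1/m], these sets intersect in [L_HC].  The ball is a Baire
    space for the strong operator topology, so only their density remains.

    Given [T0] in the ball, shrink it to norm [a < r], choose
    [max 1 a < c < r] and an orthonormal chain [f_0, ..., f_M] orthogonal to
    the finitely many vectors in play.  Compress [T0] to the orthogonal
    complement of the chain and let [f_{j+1}] go to [c f_j] and [f_0] to a short
    vector [z].  As [c] exceeds both [1] and [a], for [M] large one can choose [z]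
    so that the new operator sends [x + w] exactly to [y] after [M+1] steps, with
    [w] a small multiple of [f_M].  A conjugation close to the identity moves
    [x + w] to [x]. *)

(** * Real-valued norms *)

(** The norm of a space over [R[i]] takes values in [R[i]]; its real part carries the same
    information and brings the estimates into the ordered field [R]. *)
Definition nrm (R : realType) (V : normedZmodType R[i]) (x : V) : R :=
  complex.Re `|x|.
Arguments nrm {R V} x.

Section RealNorm.
Context {R : realType}.

Lemma nrmE (V : normedZmodType R[i]) (x : V) : `|x| = ((nrm x)%:C)%C.
Proof. by rewrite /nrm RRe_real // ger0_real. Qed.

Lemma nrm_ge0 (V : normedZmodType R[i]) (x : V) : 0 <= nrm x.
Proof. by rewrite -ler0c -nrmE. Qed.

Lemma nrm_triangle (V : normedZmodType R[i]) (x y : V) :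
  nrm (x + y) <= nrm x + nrm y.
Proof. by rewrite -lecR rmorphD /= -!nrmE ler_normD. Qed.

Lemma nrmN (V : normedZmodType R[i]) (x : V) : nrm (- x) = nrm x.
Proof. by rewrite /nrm normrN. Qed.

Lemma nrm_sub (V : normedZmodType R[i]) (x y : V) : nrm (x - y) = nrm (y - x).
Proof. by rewrite -nrmN opprB. Qed.

Lemma nrm_dist_triangle (V : normedZmodType R[i]) (y x z : V) :
  nrm (x - z) <= nrm (x - y) + nrm (y - z).
Proof. by have := nrm_triangle (x - y) (y - z); rewrite addrA subrK. Qed.

Lemma nrm0 (V : normedZmodType R[i]) : nrm (0 : V) = 0.
Proof. by rewrite /nrm normr0. Qed.

Lemma nrm_eq0 (V : normedZmodType R[i]) (x : V) : nrm x = 0 -> x = 0.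
Proof. by move=> x0; apply/eqP; rewrite -normr_eq0 nrmE x0. Qed.

Lemma nrm_gt0 (V : normedZmodType R[i]) (x : V) : x <> 0 -> 0 < nrm x.
Proof.
move=> x0; rewrite lt_neqAle nrm_ge0 andbT eq_sym; apply/eqP => nx0.
exact/x0/nrm_eq0.
Qed.

Lemma nrmZ (V : normedModType R[i]) (a : R[i]) (x : V) :
  nrm (a *: x) = nrm a * nrm x.
Proof. by apply: complexI; rewrite rmorphM /= -!nrmE normrZ. Qed.

Lemma nrmR (a : R) : 0 <= a -> nrm ((a%:C)%C : R[i]) = a.
Proof. by move=> a0; apply: complexI; rewrite -nrmE ger0_norm // ler0c. Qed.

Lemma nrmM (a b : R[i]) : nrm (a * b) = nrm a * nrm b.
Proof. by apply: complexI; rewrite rmorphM /= -!nrmE normrM. Qed.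

Lemma nrm_lt (V : normedZmodType R[i]) (x : V) (e : R) :
  (`|x| < (e%:C)%C) = (nrm x < e).
Proof. by rewrite nrmE ltcR. Qed.

Lemma nrm_le_eps (V : normedZmodType R[i]) (x : V) :
  (forall e, 0 < e -> nrm x <= e) -> x = 0.
Proof.
move=> h; apply: nrm_eq0; apply/eqP; rewrite eq_le nrm_ge0 andbT.
by apply/ler_addgt0Pr => e /h; rewrite add0r.
Qed.

(** A positive element of [R[i]] is real, so balls of real radius already form a neighbourhood
    basis. *)
Lemma dense_nrm (V : normedModType R[i]) (S : set V) :
  dense S <-> forall (y : V) (e : R), 0 < e -> exists2 s, S s & nrm (s - y) < e.
Proof.
split=> [dS y e e0|h U [y Uy] oU].
  have ec0 : 0 < (e%:C)%C by rewrite ltcR.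
  have [|s [bs Ss]] := dS _ _ (ball_open y (e%:C)%C).
    by exists y; exact: ballxx.
  exists s => //; move: bs; rewrite -ball_normE /ball_ /= nrm_sub.
  by rewrite nrm_lt.
have /nbhs_ballP[e /= e0 yeU] : nbhs y U by exact: open_nbhs_nbhs.
have eE : e = ((complex.Re e)%:C)%C by rewrite RRe_real // gtr0_real.
have [|s Ss sy] := h y (complex.Re e); first by rewrite -ltcR -eE.
exists s; split => //; apply: yeU.
by rewrite -ball_normE /ball_ /= eE nrm_lt nrm_sub.
Qed.

Definition nrm_cvg (V : normedZmodType R[i]) (u : nat -> V) (l : V) :=
  forall e : R, 0 < e -> exists N, forall n, (N <= n)%N -> nrm (u n - l) < e.

Lemma nrm_cauchy_cvg (V : completeNormedModType R[i]) (u : nat -> V) :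
  (forall e : R, 0 < e -> exists N, forall m n, (N <= m)%N -> (N <= n)%N ->
     nrm (u m - u n) < e) ->
  exists l, nrm_cvg u l.
Proof.
move=> cu.
have eE (e : R[i]) : 0 < e -> e = ((complex.Re e)%:C)%C.
  by move=> e0; rewrite RRe_real // gtr0_real.
have /cvg_ex[l ul] : cvg (u @ \oo).
  apply/cauchy_cvgP; apply/cauchy_exP => e e0.
  have [|N hN] := cu (complex.Re e); first by rewrite -ltcR -eE.
  exists (u N); exists N => // n /= Nn.
  by rewrite -ball_normE /ball_ /= (eE e e0) nrm_lt hN.
exists l => e e0.
have ec0 : 0 < (e%:C)%C :> R[i] by rewrite ltcR.
have [N _ hN] := (@cvgrPdist_lt _ _ _ _ _ u l).1 ul _ ec0.
by exists N => n Nn; rewrite nrm_sub -nrm_lt; apply: hN.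
Qed.

End RealNorm.

(** * Linear operators and orthonormal sequences *)

Section LinearOperators.
Context {R : realType} {H : normedModType R[i]}.
Implicit Types (S T : H -> H) (u v : H).

Lemma linear_opD T : is_linear_op T -> {morph T : u v / u + v}.
Proof. by move=> lT u v; have := lT 1 u v; rewrite !scale1r. Qed.

Lemma linear_op0 T : is_linear_op T -> T 0 = 0.
Proof.
move=> lT; have /eqP := linear_opD lT 0 0.
by rewrite addr0 -subr_eq subrr => /eqP.
Qed.

Lemma linear_opZ T a : is_linear_op T -> {morph T : u / a *: u}.
Proof. by move=> lT u; have := lT a u 0; rewrite !addr0 linear_op0 // addr0. Qed.

Lemma linear_opB T : is_linear_op T -> {morph T : u v / u - v}.
Proof.
by move=> lT u v; rewrite linear_opD // -scaleN1r linear_opZ // scaleN1r.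
Qed.

Lemma linear_op_comp S T :
  is_linear_op S -> is_linear_op T -> is_linear_op (S \o T).
Proof. by move=> lS lT a u v /=; rewrite lT lS. Qed.

Lemma linear_op_add S T :
  is_linear_op S -> is_linear_op T -> is_linear_op (fun u => S u + T u).
Proof. by move=> lS lT a u v /=; rewrite lT lS scalerDr addrACA. Qed.

Lemma linear_op_scale b T :
  is_linear_op T -> is_linear_op (fun u => b *: T u).
Proof. by move=> lT a u v; rewrite lT scalerDr !scalerA mulrC. Qed.

Lemma linear_op_sum n (T : nat -> H -> H) :
  (forall j, is_linear_op (T j)) -> is_linear_op (fun u => \sum_(j < n) T j u).
Proof.
move=> lT a u v; rewrite scaler_sumr -big_split /=.
by apply: eq_bigr => j _; rewrite lT.
Qed.

Lemma linear_op_iterD T n : is_linear_op T -> {morph iter n T : u v / u + v}.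
Proof. by move=> lT u v; elim: n => //= n ->; rewrite linear_opD. Qed.

Lemma linear_op_iterZ T n a : is_linear_op T -> {morph iter n T : u / a *: u}.
Proof. by move=> lT u; elim: n => //= n ->; rewrite linear_opZ. Qed.

Lemma nrm_iter_le T (a : R) n u : 0 <= a ->
  (forall v, nrm (T v) <= a * nrm v) -> nrm (iter n T u) <= a ^+ n * nrm u.
Proof.
move=> a0 hT; elim: n => [|n IH] /=; first by rewrite expr0 mul1r.
by rewrite (le_trans (hT _)) // exprS -mulrA ler_wpM2l.
Qed.

Lemma ball_opsP (r : R) T :
  ball_ops r T <-> is_linear_op T /\ forall u, nrm (T u) <= r * nrm u.
Proof.
split=> -[lT hT]; split => // u; have := hT u;
  by rewrite !nrmE -rmorphM /= lecR.
Qed.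

End LinearOperators.

(** * Inner-product calculus, Pythagoras and Gram-Schmidt *)

Section InnerProduct.
Context {R : realType} {H : normedModType R[i]} (ip : H -> H -> R[i]).
Hypothesis Hip : is_inner_product ip.
Implicit Types (u v w : H).

Lemma ipDl u v w : ip (u + v) w = ip u w + ip v w.
Proof. by have [h _ _] := Hip; have := h 1 u v w; rewrite scale1r mul1r. Qed.

Lemma ip0l w : ip 0 w = 0.
Proof.
by have /eqP := ipDl 0 0 w; rewrite addr0 -subr_eq subrr => /eqP.
Qed.

Lemma ipZl a u w : ip (a *: u) w = a * ip u w.
Proof. by have [h _ _] := Hip; have := h a u 0 w; rewrite !addr0 ip0l addr0. Qed.

Lemma ipNl u w : ip (- u) w = - ip u w.
Proof. by rewrite -scaleN1r ipZl mulN1r. Qed.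

Lemma ipBl u v w : ip (u - v) w = ip u w - ip v w.
Proof. by rewrite ipDl ipNl. Qed.

Lemma ip_suml n (F : 'I_n -> H) w : ip (\sum_i F i) w = \sum_i ip (F i) w.
Proof.
elim/big_ind2 : _ => [|x a y b <- <-|//]; first exact: ip0l.
exact: ipDl.
Qed.

Lemma ip_conj u v : ip u v = conjc (ip v u).
Proof. by have [_ h _] := Hip. Qed.

Lemma ip_orthC u v : ip u v = 0 -> ip v u = 0.
Proof. by move=> uv; rewrite ip_conj uv conjc0. Qed.

Lemma ipvv u : ip u u = ((nrm u ^+ 2)%:C)%C.
Proof. by have [_ _ ->] := Hip; rewrite nrmE -rmorphXn. Qed.

Lemma pythagoras u v : ip u v = 0 -> nrm (u + v) ^+ 2 = nrm u ^+ 2 + nrm v ^+ 2.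
Proof.
move=> uv; have vu := ip_orthC uv; apply: complexI.
rewrite rmorphD /= -!ipvv ipDl (ip_conj u) (ip_conj v) !ipDl uv vu.
by rewrite addr0 add0r -!ip_conj.
Qed.

Lemma ip_suml_orth n (c : nat -> R[i]) (f : nat -> H) w :
  (forall j, (j < n)%N -> ip (f j) w = 0) ->
  ip (\sum_(j < n) c j *: f j) w = 0.
Proof.
by move=> h; rewrite ip_suml big1 // => j _; rewrite ipZl h // mulr0.
Qed.

(** Gram-Schmidt by induction on [l], which may be linearly dependent: [x] and the head [v] are made
    orthogonal to the tail, giving [x'] and [v'], and then the component of [x'] along [v'] is
    removed. *)
Lemma orthogonal_decomposition (l : seq H) x :
  exists c : nat -> R[i], forall v, v \in l ->
    ip (x - \sum_(i < size l) c i *: l`_i) v = 0.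
Proof.
elim: l x => [|v l IH] x; first by exists (fun=> 0).
have [cv hv] := IH v; have [cx hx] := IH x.
set v' := v - _ in hv; set x' := x - _ in hx.
set b := ip x' v' / ip v' v'.
exists (fun k => if k is j.+1 then cx j - b * cv j else b) => w.
have -> : x - \sum_(i < size (v :: l))
    (if i : nat is j.+1 then cx j - b * cv j else b) *: (v :: l)`_i
    = x' - b *: v'.
  rewrite /= big_ord_recl /= /x' /v'.
  under eq_bigr do rewrite /= scalerBl -scalerA.
  rewrite sumrB -scaler_sumr scalerBr !opprD !opprK -!addrA.
  by congr (_ + _); rewrite addrCA.
have lorth z : z \in l -> ip (x' - b *: v') z = 0.
  by move=> zl; rewrite ipBl ipZl hx // hv // mulr0 subrr.
rewrite inE => /orP[/eqP ->|]; last exact: lorth.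
have x'v' : ip v' (x' - b *: v') = 0.
  apply: ip_orthC; rewrite ipBl ipZl /b.
  (* If [v] lies in the span of the tail, [v'] may be zero; both terms then vanish, whatever [b]
     is. *)
  have [v'0|v'0] := eqVneq (ip v' v') 0; last by rewrite divfK // subrr.
  suff -> : v' = 0 by rewrite (ip_conj x') !ip0l conjc0 mulr0 subrr.
  apply: nrm_eq0; move: v'0; rewrite ipvv => /complexI/eqP.
  by rewrite sqrf_eq0 => /eqP.
(* [v] is [v'] plus a combination of the tail, and the residual is orthogonal to both. *)
apply: ip_orthC; rewrite -(subrK (\sum_(i < size l) cv i *: l`_i) v) ipDl.
rewrite -/v' x'v' add0r (@ip_suml_orth _ cv (nth 0 l)) // => j jl.
by apply: ip_orthC; rewrite lorth // mem_nth.
Qed.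

Hypothesis Hinf : infinite_dimensional H.

(** A vector outside the span of [l] leaves a nonzero residual, which is normalised. *)
Lemma exists_unit_orthogonal (l : seq H) :
  exists u, nrm u = 1 /\ forall v, v \in l -> ip v u = 0.
Proof.
have [x hx] := Hinf (fun i : 'I_(size l) => l`_i).
have [c hc] := orthogonal_decomposition l x.
set w := x - _ in hc.
have w0 : 0 < nrm w.
  apply: nrm_gt0 => /eqP; rewrite subr_eq0 => /eqP.
  exact: hx (fun i => c i).
exists ((((nrm w)^-1)%:C)%C *: w); split.
  by rewrite nrmZ nrmR ?invr_ge0 ?nrm_ge0 // mulVf // gt_eqF.
by move=> v vl; apply: ip_orthC; rewrite ipZl hc // mulr0.
Qed.

Lemma exists_orthonormal_sequence (l : seq H) :
  exists f : nat -> H, (forall i j, ip (f i) (f j) = (i == j)%:R) /\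
    forall v j, v \in l -> ip v (f j) = 0.
Proof.
have /choice[g hg] := exists_unit_orthogonal.
(* [F n] is [l] with the first [n] chosen vectors prepended, so the vector chosen for [F n] is
   orthogonal to [l] and to all earlier choices. *)
pose F n := iter n (fun s => g s :: s) l.
have F_l n v : v \in l -> v \in F n.
  by move=> vl; elim: n => //= n IH; rewrite inE IH orbT.
have F_g i j : (i < j)%N -> g (F i) \in F j.
  elim: j => // j IH; rewrite ltnS leq_eqVlt => /orP[/eqP ->|/IH h] /=.
    by rewrite inE eqxx.
  by rewrite inE h orbT.
exists (fun n => g (F n)); split; last by move=> v j /(F_l j)/(hg _).2.
move=> i j; have [ij|ij|->] := ltngtP i j.
- by rewrite (hg _).2 //; exact: F_g.
- by apply: ip_orthC; rewrite (hg _).2 //; exact: F_g.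
by rewrite ipvv (hg _).1 expr1n.
Qed.

End InnerProduct.

(** * Finite orthonormal sums and the projection onto their complement *)

Section OrthonormalSequence.
Context {R : realType} {H : normedModType R[i]} (ip : H -> H -> R[i]).
Hypothesis Hip : is_inner_product ip.
Context (f : nat -> H).
Hypothesis Hf : forall i j, ip (f i) (f j) = (i == j)%:R.
Implicit Types (u v w : H).

Lemma nrm_orthonormal j : nrm (f j) = 1.
Proof.
have := ipvv Hip (f j); rewrite Hf eqxx => /complexI/esym/eqP.
by rewrite sqrp_eq1 ?nrm_ge0 // => /eqP.
Qed.

Lemma ip_sum_orthonormal n (a : nat -> R[i]) k :
  (k < n)%N -> ip (\sum_(j < n) a j *: f j) (f k) = a k.
Proof.
move=> kn; rewrite ip_suml // (bigD1 (Ordinal kn)) //= ipZl // Hf eqxx mulr1.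
rewrite big1 ?addr0 // => j jk; rewrite ipZl // Hf.
by rewrite -(inj_eq val_inj) /= in jk; rewrite (negbTE jk) mulr0.
Qed.

Lemma nrm_orthonormal_sum n (a : nat -> R[i]) v :
  (forall j, (j < n)%N -> ip v (f j) = 0) ->
  nrm (v + \sum_(j < n) a j *: f j) ^+ 2
  = nrm v ^+ 2 + \sum_(j < n) nrm (a j) ^+ 2.
Proof.
elim: n => [|n IH] hv; first by rewrite !big_ord0 !addr0.
rewrite !big_ord_recr /= !addrA -IH; last by move=> j jn; rewrite hv // ltnW.
rewrite [LHS](pythagoras Hip); first by rewrite nrmZ nrm_orthonormal mulr1.
apply: (ip_orthC Hip); rewrite ipZl //; apply/eqP; rewrite mulf_eq0; apply/orP.
right; apply/eqP/(ip_orthC Hip); rewrite ipDl // hv // add0r.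
by rewrite (ip_suml_orth Hip) // => j jn; rewrite Hf ltn_eqF.
Qed.

(** For orthonormal [f], the orthogonal projection onto the complement of the first [n] vectors of
    [f]. *)
Definition orthocomp n u : H := u - \sum_(j < n) ip u (f j) *: f j.

Lemma orthocomp_linear n : is_linear_op (orthocomp n).
Proof.
move=> a u v; rewrite /orthocomp.
under eq_bigr do rewrite ipDl // ipZl // scalerDl -scalerA.
by rewrite big_split /= -scaler_sumr scalerBr opprD addrACA.
Qed.

Lemma ip_orthocomp n u k : (k < n)%N -> ip (orthocomp n u) (f k) = 0.
Proof.
move=> kn; rewrite ipBl //.
by rewrite (ip_sum_orthonormal (fun j => ip u (f j)) kn) subrr.
Qed.

Lemma orthocomp_id n u : (forall j, (j < n)%N -> ip u (f j) = 0) ->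
  orthocomp n u = u.
Proof.
by move=> h; rewrite /orthocomp big1 ?subr0 // => j _; rewrite h // scale0r.
Qed.

Lemma nrm_orthocomp n u :
  nrm u ^+ 2 = nrm (orthocomp n u) ^+ 2 + \sum_(j < n) nrm (ip u (f j)) ^+ 2.
Proof.
rewrite -(nrm_orthonormal_sum (fun j => ip u (f j))) ?subrK // => j.
exact: ip_orthocomp.
Qed.

Lemma nrm_orthocomp_le n u : nrm (orthocomp n u) <= nrm u.
Proof.
rewrite -(@ler_pXn2r _ 2) ?nnegrE ?nrm_ge0 // (nrm_orthocomp n u) lerDl.
by apply: sumr_ge0 => j _; exact: sqr_ge0.
Qed.

End OrthonormalSequence.

(** * Compression completed by a weighted shift *)

(** Since [c] exceeds both 1 and [a], its powers outgrow a constant plus a multiple of the powers of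
    [a]. This later fixes the length of the chain. *)
Lemma geometric_domination (R : realType) (a c p q e : R) :
  0 <= a -> a < c -> 1 < c -> 0 <= p -> 0 <= q -> 0 < e ->
  exists M, p + a ^+ M.+1 * q <= e * c ^+ M.
Proof.
move=> a0 ac c1 p0 q0 e0; have c0 : 0 < c by lra.
pose b := Num.max 1 a.
have b0 : 0 < b by rewrite /b lt_max ltr01.
have bc : b < c by rewrite /b gt_max c1.
pose K := p + a * q; have K0 : 0 <= K by rewrite addr_ge0 // mulr_ge0.
have bc1 : `|b / c| < 1.
  by rewrite ger0_norm ?divr_ge0 ?(ltW b0) ?(ltW c0) // ltr_pdivrMr // mul1r.
(* The [+ 1] keeps the denominator positive when [K = 0]. *)
have eK : 0 < e / (K + 1) by rewrite divr_gt0 //; lra.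
have [M _ /(_ M (leqnn M))] := (cvgr0Pnorm_lt _).1 (cvg_expr bc1) _ eK.
rewrite ger0_norm ?exprn_ge0 ?divr_ge0 ?(ltW b0) ?(ltW c0) // => hM.
exists M; rewrite exprS -mulrA mulrCA.
have bM1 : 1 <= b ^+ M by rewrite exprn_ege1 // /b le_max lexx.
have aM : a ^+ M <= b ^+ M.
  by rewrite lerXn2r ?nnegrE ?(ltW b0) // /b le_max lexx orbT.
have : p + a ^+ M * (a * q) <= b ^+ M * K.
  rewrite /K mulrDr lerD // ?ler_peMl //.
  by rewrite ler_wpM2r // mulr_ge0.
move=> /le_trans; apply.
move: hM; rewrite expr_div_n ltr_pdivlMr; last by lra.
rewrite mulrAC ltr_pdivrMr ?exprn_gt0 // => /ltW; apply: le_trans.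
by rewrite ler_wpM2l ?exprn_ge0 ?(ltW b0) //; lra.
Qed.

Section ShiftPerturbation.
Context {R : realType} {H : normedModType R[i]} (ip : H -> H -> R[i]).
Hypothesis Hip : is_inner_product ip.
Context (f : nat -> H).
Hypothesis Hf : forall i j, ip (f i) (f j) = (i == j)%:R.
Context (T0 : H -> H) (M : nat) (a c : R) (z : H).
Hypothesis lT0 : is_linear_op T0.
Hypothesis a_ge0 : 0 <= a.
Hypothesis a_lt_c : a < c.
Hypothesis T0_le : forall u, nrm (T0 u) <= a * nrm u.
Hypothesis z_orth : forall j, (j < M.+1)%N -> ip z (f j) = 0.
Hypothesis z_le : nrm z <= c - a.

Local Notation P := (orthocomp ip f M.+1).
Local Notation cC := ((c%:C)%C : R[i]).

Definition compression u : H := P (T0 (P u)).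

(** The terms are the block on the complement of the chain, the exit from [f 0] back into that
    complement, and the backward shift of weight [c] along the chain. *)
Definition shift_op u : H :=
  compression u + ip u (f 0) *: z
  + \sum_(j < M) (cC * ip u (f j.+1)) *: f j.

Lemma shift_op_linear : is_linear_op shift_op.
Proof.
have lip g v : is_linear_op (fun u => ip u g *: v).
  by move=> b u w; rewrite ipDl // ipZl // scalerDl scalerA.
apply: linear_op_add.
  apply: linear_op_add => //; have lP := orthocomp_linear Hip f M.+1.
  by apply: (linear_op_comp lP); apply: (linear_op_comp lT0).
apply: (@linear_op_sum _ _ M (fun j u => (cC * ip u (f j.+1)) *: f j)) => j.
have -> : (fun u => (cC * ip u (f j.+1)) *: f j)
    = (fun u => cC *: (ip u (f j.+1) *: f j)).
  by apply/funext => u; rewrite scalerA.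
exact: linear_op_scale.
Qed.

(* With [z] bounded by [c - a], the first block has norm at most [c] since
   [(a p + (c - a) q)^2 <= c^2 (p^2 + q^2)]. *)
Lemma nrm_shift_op u : nrm (shift_op u) <= c * nrm u.
Proof.
have c0 : 0 <= c by exact: le_trans a_ge0 (ltW a_lt_c).
rewrite -(@ler_pXn2r _ 2) ?nnegrE ?mulr_ge0 ?nrm_ge0 // exprMn.
(* Pythagoras on both sides: the shift terms contribute exactly [c ^+ 2] times the squared
   coefficients of [u] at [f 1, ..., f M], so only [P u] and the coefficient at [f 0] remain to be
   compared. *)
rewrite (nrm_orthocomp Hip Hf M.+1 u) big_ord_recl /=.
rewrite (nrm_orthonormal_sum Hip Hf (fun j => cC * ip u (f j.+1))); last first.
  move=> j jM; have jM1 : (j < M.+1)%N by rewrite ltnW.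
  by rewrite ipDl // ipZl // z_orth // ip_orthocomp // mulr0 addr0.
have -> : \sum_(j < M) nrm (cC * ip u (f j.+1)) ^+ 2
    = c ^+ 2 * \sum_(j < M) nrm (ip u (f j.+1)) ^+ 2.
  by rewrite mulr_sumr; apply: eq_bigr => j _; rewrite nrmM nrmR // exprMn.
rewrite addrA mulrDr; apply: lerD => //.
have h1 : nrm (compression u + ip u (f 0) *: z)
    <= a * nrm (P u) + (c - a) * nrm (ip u (f 0)).
  rewrite (le_trans (nrm_triangle _ _)) // lerD //.
    exact: (le_trans (nrm_orthocomp_le Hip Hf _ _)).
  by rewrite nrmZ mulrC ler_wpM2r // nrm_ge0.
apply: (@le_trans _ _ ((a * nrm (P u) + (c - a) * nrm (ip u (f 0))) ^+ 2)).
  by rewrite lerXn2r ?nnegrE ?nrm_ge0 // (le_trans (nrm_ge0 _) h1).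
move: (nrm_ge0 (P u)) (nrm_ge0 (ip u (f 0))).
move: (nrm (P u)) (nrm (ip u (f 0))) => p q p0 q0.
have k0 : 0 <= c - a by rewrite subr_ge0 ltW.
rewrite -subr_ge0.
have -> : c ^+ 2 * (p ^+ 2 + q ^+ 2) - (a * p + (c - a) * q) ^+ 2
  = a ^+ 2 * q ^+ 2 + (c - a) ^+ 2 * p ^+ 2
    + a * (c - a) * (p ^+ 2 + q ^+ 2 + (p - q) ^+ 2) by ring.
apply: addr_ge0; first by apply: addr_ge0; rewrite mulr_ge0 ?sqr_ge0.
apply: mulr_ge0; first exact: mulr_ge0.
by apply: addr_ge0; [apply: addr_ge0|]; exact: sqr_ge0.
Qed.

Lemma orthocomp_f k : (k < M.+1)%N -> P (f k) = 0.
Proof.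
move=> kM; rewrite /orthocomp (bigD1 (Ordinal kM)) //= Hf eqxx scale1r.
rewrite big1 ?addr0 ?subrr // => j jk; rewrite Hf eq_sym.
by rewrite -(inj_eq val_inj) /= in jk; rewrite (negbTE jk) scale0r.
Qed.

Lemma compression_f k : (k < M.+1)%N -> compression (f k) = 0.
Proof.
move=> kM; rewrite /compression orthocomp_f // (linear_op0 lT0).
exact/linear_op0/orthocomp_linear.
Qed.

Lemma shift_op_f0 : shift_op (f 0) = z.
Proof.
rewrite /shift_op compression_f // add0r Hf scale1r big1 ?addr0 // => j _.
by rewrite Hf mulr0 scale0r.
Qed.

Lemma shift_op_fS k : (k < M)%N -> shift_op (f k.+1) = cC *: f k.
Proof.
move=> kM; rewrite /shift_op compression_f ?ltnS // add0r Hf scale0r add0r.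
rewrite (bigD1 (Ordinal kM)) //= Hf eqxx mulr1 big1 ?addr0 // => j jk.
rewrite Hf eqSS eq_sym.
by rewrite -(inj_eq val_inj) /= in jk; rewrite (negbTE jk) mulr0 scale0r.
Qed.

Lemma shift_op_orth u : (forall j, (j < M.+1)%N -> ip u (f j) = 0) ->
  shift_op u = compression u.
Proof.
move=> hu; rewrite /shift_op hu // scale0r addr0 big1 ?addr0 // => j _.
by rewrite hu ?mulr0 ?scale0r // ltnS.
Qed.

Lemma iter_compression_orth k u : (forall j, (j < M.+1)%N -> ip u (f j) = 0) ->
  forall j, (j < M.+1)%N -> ip (iter k compression u) (f j) = 0.
Proof. by case: k => //= k _ j; exact: (ip_orthocomp Hip Hf). Qed.

(** The compression takes values in the complement of the chain, so an orbit that starts there never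
    meets the shift. *)
Lemma iter_shift_op_orth k u : (forall j, (j < M.+1)%N -> ip u (f j) = 0) ->
  iter k shift_op u = iter k compression u.
Proof.
move=> hu; elim: k => //= k ->; rewrite shift_op_orth //.
exact: iter_compression_orth.
Qed.

Lemma iter_shift_op_f k : (k <= M)%N ->
  iter k shift_op (f k) = cC ^+ k *: f 0.
Proof.
elim: k => [|k IH] kM; first by rewrite expr0 scale1r.
rewrite iterSr shift_op_fS // linear_op_iterZ; last exact: shift_op_linear.
by rewrite IH 1?ltnW // scalerA -exprS.
Qed.

(** [M] steps bring [f M] down to a multiple of [f 0], and one more step leaves the chain through
    [z]. *)
Lemma iter_shift_op_last : iter M.+1 shift_op (f M) = cC ^+ M *: z.
Proof.
by rewrite iterS iter_shift_op_f // linear_opZ ?shift_op_f0 //;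
  exact: shift_op_linear.
Qed.

Lemma nrm_compression u : nrm (compression u) <= a * nrm u.
Proof.
apply: (le_trans (nrm_orthocomp_le Hip Hf _ _)); apply: (le_trans (T0_le _)).
by rewrite ler_wpM2l // nrm_orthocomp_le.
Qed.

End ShiftPerturbation.

(** * Density of approaching operators *)

Section Transitivity.
Context {R : realType} {H : normedModType R[i]} (ip : H -> H -> R[i]).
Hypothesis Hip : is_inner_product ip.
Hypothesis Hinf : infinite_dimensional H.

Lemma exists_transitive_perturbation (T0 : H -> H) (a c s : R) (x y : H)
    (l : seq H) :
  is_linear_op T0 -> 0 <= a -> a < c -> 1 < c -> 0 < s ->
  (forall u, nrm (T0 u) <= a * nrm u) ->
  exists (T : H -> H) (w : H) (N : nat),
    [/\ is_linear_op T, forall u, nrm (T u) <= c * nrm u,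
        forall v, v \in l -> T v = T0 v,
        nrm w = s /\ ip w x = 0 & iter N T (x + w) = y].
Proof.
move=> lT0 a0 ac c1 s0 hT0.
have c0 : 0 < c by lra.
have ks : 0 < (c - a) * s by rewrite mulr_gt0 // subr_gt0.
(* This [M] makes [nrm y + a^(M+1) nrm x] at most [(c - a) s c^M], which bounds [z] below. *)
have [M hM] := geometric_domination a0 ac c1 (nrm_ge0 y) (nrm_ge0 x) ks.
(* Orthogonality of the chain to each [v] in [l] and to [T0 v] makes the compression agree with [T0]
   on [l]. *)
have [f [Hf fl]] :=
  exists_orthonormal_sequence Hip Hinf (x :: y :: l ++ [seq T0 v | v <- l]).
have fx j : ip x (f j) = 0 by apply: fl; rewrite inE eqxx.
have fy j : ip y (f j) = 0 by apply: fl; rewrite !inE eqxx orbT.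
have fv v j : v \in l -> ip v (f j) = 0.
  by move=> vl; apply: fl; rewrite !inE mem_cat vl !orbT.
have fTv v j : v \in l -> ip (T0 v) (f j) = 0.
  by move=> vl; apply: fl; rewrite !inE mem_cat map_f // !orbT.
pose A := compression ip f T0 M.
have scM : 0 < s * c ^+ M by rewrite mulr_gt0 // exprn_gt0.
(* With [w = s f_M], the vector [x + w] becomes [A^(M+1) x + s c^M z] after [M+1] steps; [z] solves
   for the value [y]. *)
pose z := (((s * c ^+ M)^-1)%:C)%C *: (y - iter M.+1 A x).
have z_orth j : (j < M.+1)%N -> ip z (f j) = 0.
  move=> jM; rewrite ipZl // ipBl // fy iter_compression_orth // subrr.
  by rewrite mulr0.
have z_le : nrm z <= c - a.
  rewrite nrmZ nrmR ?invr_ge0 ?(ltW scM) // mulrC ler_pdivrMr //.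
  rewrite mulrA; apply: le_trans hM; rewrite (le_trans (nrm_triangle _ _)) //.
  rewrite nrmN lerD2l; apply: nrm_iter_le => // u.
  exact: nrm_compression.
exists (shift_op ip f T0 M c z), ((s%:C)%C *: f M), M.+1; split.
- exact: shift_op_linear.
- by move=> u; apply: (nrm_shift_op Hip Hf a0 ac).
- move=> v vl; rewrite shift_op_orth // => [|j _]; last exact: fv.
  rewrite /compression (@orthocomp_id _ _ _ _ _ v) => [|j _]; last exact: fv.
  by rewrite orthocomp_id // => j _; exact: fTv.
- split; first by rewrite nrmZ nrmR ?(ltW s0) // (nrm_orthonormal Hip Hf) mulr1.
  by rewrite ipZl // (ip_orthC Hip (fx M)) mulr0.
have lS := shift_op_linear Hip f M c z lT0.
rewrite linear_op_iterD // linear_op_iterZ // iter_shift_op_orth //.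
rewrite iter_shift_op_last // /z !scalerA ?mulrA.
have -> : (s%:C * c%:C ^+ M * ((s * c ^+ M)^-1)%:C)%C = 1 :> R[i].
  rewrite -rmorphXn -!rmorphM /= divff ?gt_eqF //.
by rewrite scale1r addrC subrK.
Qed.

(* [T] carries [x + w] to [y]; conjugating by the near-identity
   [u |-> u - phi u *: w], which sends [x + w] to [x], transfers this to [x]. *)
Lemma exists_conjugate (T : H -> H) (c s : R) (x w : H) :
  is_linear_op T -> 0 <= c -> (forall u, nrm (T u) <= c * nrm u) ->
  x <> 0 -> 0 <= s -> nrm w = s * nrm x -> ip w x = 0 ->
  exists T' : H -> H,
    [/\ is_linear_op T',
        forall u, nrm (T' u) <= (1 + s) ^+ 2 * c * nrm u,
        forall u, nrm (T' u - T u) <= c * s * (2 + s) * nrm u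
      & forall n, nrm (iter n T' x - iter n T (x + w))
                  <= s * nrm (iter n T (x + w))].
Proof.
move=> lT c0 hT x0 s0 ws wx.
(* The functional [phi] is 1 at [x] and 0 at [w]; the latter makes [L'] undo [L] below. *)
pose phi u := ip u x / ip x x.
have ipxx0 : ip x x != 0.
  rewrite ipvv //; apply/eqP => /complexI/eqP; rewrite sqrf_eq0 => /eqP.
  by move/nrm_eq0.
have phiD u v b : phi (b *: u + v) = b * phi u + phi v.
  by rewrite /phi ipDl // ipZl // mulrDl mulrA.
have phiw : phi w = 0 by rewrite /phi wx mul0r.
have phix : phi x = 1 by rewrite /phi divff.
(* [phi u *: x] is the orthogonal projection of [u] onto the line of [x], hence no longer than [u];
   replacing [x] by [w] scales the norm by [s]. *)
have nphi u : nrm (phi u *: w) <= s * nrm u.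
  rewrite nrmZ ws mulrCA ler_wpM2l // -nrmZ.
  rewrite -(@ler_pXn2r _ 2) ?nnegrE ?nrm_ge0 //.
  rewrite -[X in _ <= nrm X ^+ 2](subrK (phi u *: x) u).
  rewrite (pythagoras Hip) ?lerDr ?sqr_ge0 //.
  apply: (ip_orthC Hip); rewrite ipZl //; apply/eqP; rewrite mulf_eq0; apply/orP.
  right; apply/eqP/(ip_orthC Hip).
  by rewrite ipBl // ipZl // /phi divfK // subrr.
pose L u := u - phi u *: w; pose L' u := u + phi u *: w.
have lL : is_linear_op L.
  move=> b u v; rewrite /L phiD scalerDl scalerBr -scalerA opprD.
  by rewrite addrACA.
have lL' : is_linear_op L'.
  move=> b u v; rewrite /L' phiD scalerDl scalerDr -scalerA.
  by rewrite addrACA.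
have L'L u : L' (L u) = u.
  rewrite /L' /L.
  have -> : phi (u - phi u *: w) = phi u.
    by rewrite addrC -scaleNr phiD phiw mulr0 add0r.
  by rewrite subrK.
have nL u : nrm (L u) <= (1 + s) * nrm u.
  rewrite (le_trans (nrm_triangle _ _)) // nrmN mulrDl mul1r lerD2l.
  exact: nphi.
have nL' u : nrm (L' u) <= (1 + s) * nrm u.
  rewrite (le_trans (nrm_triangle _ _)) // mulrDl mul1r lerD2l.
  exact: nphi.
have s10 : 0 <= 1 + s by lra.
have nTL' u : nrm (T (L' u)) <= c * ((1 + s) * nrm u).
  by rewrite (le_trans (hT _)) // ler_wpM2l.
exists (fun u => L (T (L' u))); split.
- by apply: (linear_op_comp lL); apply: (linear_op_comp lT).
- move=> u; rewrite (le_trans (nL _)) // expr2 -!mulrA ler_wpM2l //.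
  by rewrite mulrCA.
(* [L T L' - T] is split as [(L - 1) T L' + T (L' - 1)], bounded by [s c (1 + s)] and [c s]. *)
- move=> u; apply: (le_trans (nrm_dist_triangle (T (L' u)) _ _)).
  rewrite -linear_opB //.
  have -> : L (T (L' u)) - T (L' u) = - (phi (T (L' u)) *: w).
    by rewrite /L addrAC subrr add0r.
  have -> : L' u - u = phi u *: w by rewrite /L' addrAC subrr add0r.
  rewrite nrmN.
  have h1 := nphi (T (L' u)); have h2 := nTL' u; have h3 := hT (phi u *: w).
  have h4 := nphi u.
  have h5 : s * nrm (T (L' u)) <= s * (c * ((1 + s) * nrm u)).
    exact: ler_wpM2l.
  have h6 : c * nrm (phi u *: w) <= c * (s * nrm u) by exact: ler_wpM2l.
  by lra.
- move=> n.
  (* The inner factors [L' L] cancel, and [x = L (x + w)] starts the induction. *)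
  have -> : iter n (fun u => L (T (L' u))) x = L (iter n T (x + w)).
    elim: n => [|n IH] /=; last by rewrite IH L'L.
    have := phiD x w 1; rewrite scale1r mul1r phix phiw addr0 /L => ->.
    by rewrite scale1r addrK.
  by rewrite /L addrAC subrr add0r nrmN nphi.
Qed.

(** [T0] is scaled by [1 - h] to leave room below [r], perturbed to send [x + w] to [y], then
    conjugated to start from [x]; the parameters keep each of the three errors small. *)
Lemma exists_close_operator (r : R) (T0 : H -> H) n (xs : 'I_n -> H) (x y : H)
    (e d : R) :
  1 < r -> ball_ops r T0 -> x <> 0 -> 0 < e -> 0 < d ->
  exists T : H -> H, [/\ ball_ops r T,
    forall i, nrm (T (xs i) - T0 (xs i)) < e
    & exists N, nrm (iter N T x - y) < d].
Proof.
move=> r1 /ball_opsP[lT0 hT0] x0 e0 d0.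
(* [B] bounds [y] and every [xs i]; the summand 1 makes it positive, so that it can be divided
   by. *)
pose B := 1 + nrm y + \sum_(i < n) nrm (xs i).
have sB : 0 <= \sum_(i < n) nrm (xs i).
  by apply: sumr_ge0 => i _; exact: nrm_ge0.
have y0 := nrm_ge0 y.
have B0 : 0 < B by rewrite /B; lra.
have yB : nrm y <= B by rewrite /B; lra.
have xB i : nrm (xs i) <= B.
  have : nrm (xs i) <= \sum_(i < n) nrm (xs i).
    rewrite (bigD1 i) //= lerDl; apply: sumr_ge0 => j _; exact: nrm_ge0.
  by rewrite /B; lra.
have rB : 0 < r * B by rewrite mulr_gt0 //; lra.
pose h := Num.min 1 (e / (4 * (r * B))).
have h0 : 0 < h by rewrite /h lt_min ltr01 divr_gt0 // mulr_gt0.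
have h1 : h <= 1 by rewrite /h ge_min lexx.
have he : h * (r * B) <= e / 4.
  rewrite -ler_pdivlMr // /h ge_min; apply/orP; right.
  by rewrite invfM mulrA.
pose t := 1 - h; pose a := t * r.
have t0 : 0 <= t by rewrite /t; lra.
have a0 : 0 <= a by rewrite mulr_ge0 //; lra.
have ar : a < r.
  by rewrite /a /t mulrBl mul1r; have := mulr_gt0 h0 (lt_trans ltr01 r1); lra.
pose c := (Num.max 1 a + r) / 2.
have [ac c1 cr] : [/\ a < c, 1 < c & c < r].
  have m1 : 1 <= Num.max 1 a by rewrite le_max lexx.
  have m2 : a <= Num.max 1 a by rewrite le_max lexx orbT.
  have m3 : Num.max 1 a < r by rewrite gt_max r1.
  by rewrite /c; split; lra.
(* The bounds on [s] serve in turn for [s^2 <= s], for [(1 + s)^2 c <= r], for a conjugation error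
   of at most [e / 4] at each [xs i], and for a final error of at most [d / 2] at [y]. *)
pose s := Num.min (Num.min 1 ((r - c) / (3 * r)))
                  (Num.min (e / (12 * (r * B))) (d / (2 * B))).
have r0 : 0 < r by lra.
have s0 : 0 < s.
  by rewrite /s !lt_min ltr01 !divr_gt0 ?mulr_gt0 // subr_gt0.
have s1 : s <= 1 by rewrite /s !ge_min lexx.
have sr : s * (3 * r) <= r - c.
  by rewrite -ler_pdivlMr ?mulr_gt0 // /s !ge_min lexx !orbT.
have se : s * (12 * (r * B)) <= e.
  by rewrite -ler_pdivlMr ?mulr_gt0 // /s !ge_min lexx !orbT.
have sd : s * (2 * B) <= d.
  by rewrite -ler_pdivlMr ?mulr_gt0 // /s !ge_min lexx !orbT.
have nx : 0 < nrm x by exact: nrm_gt0.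
have [|u|T [w [N [lT hT Tl [wn wx] Ty]]]] := @exists_transitive_perturbation
    (fun u => (t%:C)%C *: T0 u) a c (s * nrm x) x y [seq xs i | i : 'I_n]
    (linear_op_scale _ lT0) a0 ac c1.
- exact: mulr_gt0.
- by rewrite nrmZ nrmR // /a -mulrA ler_wpM2l.
have c0 : 0 <= c by lra.
have [T' [lT' nT' dT' iT']] := exists_conjugate lT c0 hT x0 (ltW s0) wn wx.
exists T'; split.
- apply/ball_opsP; split => // u; rewrite (le_trans (nT' u)) //.
  rewrite ler_wpM2r ?nrm_ge0 //.
  have : s * s <= s * 1 by rewrite ler_wpM2l // ltW.
  rewrite mulr1 => ss; have : c * (s * s) <= c * s by rewrite ler_wpM2l.
  have : c * s <= r * s by rewrite ler_wpM2r // ltW.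
  by rewrite expr2; lra.
(* [T (xs i)] is exactly [(1 - h) T0 (xs i)], so conjugation and scaling each cost at most
   [e / 4]. *)
- move=> i; apply: (le_lt_trans (nrm_dist_triangle (T (xs i)) _ _)).
  have := dT' (xs i); rewrite (Tl (xs i)); last exact: codom_f.
  have -> : (t%:C)%C *: T0 (xs i) - T0 (xs i) = - ((h%:C)%C *: T0 (xs i)).
    by rewrite /t rmorphB /= scalerBl scale1r addrAC subrr add0r.
  rewrite nrmN nrmZ nrmR ?(ltW h0) //.
  have : h * nrm (T0 (xs i)) <= h * (r * B).
    rewrite ler_wpM2l ?(ltW h0) // (le_trans (hT0 _)) // ler_wpM2l //.
    exact: ltW.
  have cs : 0 <= c * s by rewrite mulr_ge0 // ltW.
  have : c * s * (2 + s) * nrm (xs i) <= c * s * 3 * B.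
    apply: ler_pM => //; rewrite ?nrm_ge0 //.
      by apply: mulr_ge0 => //; lra.
    by apply: ler_wpM2l => //; lra.
  have : c * (s * B) <= r * (s * B).
    by rewrite ler_wpM2r ?mulr_ge0 ?(ltW s0) ?(ltW B0) ?(ltW cr).
  by lra.
exists N; have := iT' N; rewrite Ty => /le_lt_trans; apply.
have : s * nrm y <= s * B by rewrite ler_wpM2l // ltW.
by lra.
Qed.

End Transitivity.

(** * The strong operator topology *)

Section StrongOperatorTopology.
Context {R : realType} {H : normedModType R[i]}.
Implicit Types (B U V : set (H -> H)) (S T : H -> H) (l : seq H) (e r : R).

(** Lists in place of indexed families let neighbourhoods be intersected by concatenation. *)
Lemma sot_openP B U : sot_open_in B U <-> U `<=` B /\
  forall T, U T -> exists l e, 0 < e /\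
    forall S, B S -> (forall v, v \in l -> nrm (S v - T v) < e) -> U S.
Proof.
split=> -[UB hU]; split=> // T /hU.
- move=> [n [xs [e [e0 h]]]]; exists [seq xs i | i : 'I_n], e; split => //.
  by move=> S BS hS; apply: h => // i; rewrite nrm_lt hS // codom_f.
- move=> [l [e [e0 h]]]; exists (size l), (fun i => l`_i), e; split => //.
  move=> S BS hS; apply: h => // v vl.
  have il : (index v l < size l)%N by rewrite index_mem.
  by have := hS (Ordinal il); rewrite nrm_lt /= nth_index.
Qed.

Lemma sot_openI B U V :
  sot_open_in B U -> sot_open_in B V -> sot_open_in B (U `&` V).
Proof.
move=> /sot_openP[UB hU] /sot_openP[VB hV]; apply/sot_openP.
split=> [T [/UB]//|T [/hU[l [e [e0 h]]] /hV[l' [e' [e'0 h']]]]].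
exists (l ++ l'), (Num.min e e'); split; first by rewrite lt_min e0.
move=> S BS hS; split; [apply: h|apply: h'] => // v vl.
  have := hS v; rewrite mem_cat vl lt_min => /(_ isT)/andP[]//.
have := hS v; rewrite mem_cat vl orbT lt_min => /(_ isT)/andP[]//.
Qed.

(** Finitely many strict inequalities share a positive margin; this is what makes basic
    neighbourhoods open. *)
Lemma seq_uniform_gap (T : eqType) (l : seq T) (g : T -> R) e :
  (forall v, v \in l -> g v < e) ->
  exists2 d, 0 < d & forall v, v \in l -> g v + d <= e.
Proof.
elim: l => [|v l IH] h; first by exists 1.
have [w wl|d d0 hd] := IH; first by apply: h; rewrite inE wl orbT.
have gv : g v < e by apply: h; rewrite inE eqxx.
exists (Num.min d (e - g v)); first by rewrite lt_min d0 subr_gt0.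
have m1 : Num.min d (e - g v) <= d by rewrite ge_min lexx.
have m2 : Num.min d (e - g v) <= e - g v by rewrite ge_min lexx orbT.
move=> w; rewrite inE => /orP[/eqP ->|/hd]; last by lra.
by lra.
Qed.

Lemma sot_open_basic B T l e :
  sot_open_in B (B `&` [set S | forall v, v \in l -> nrm (S v - T v) < e]).
Proof.
apply/sot_openP; split=> [S []//|S [BS /seq_uniform_gap[d d0 hd]]].
exists l, d; split => // S' BS' hS'; split => // v vl.
apply: le_lt_trans (nrm_dist_triangle (S v) _ _) _.
have := hS' v vl; have := hd v vl; lra.
Qed.

Definition approach_set r (x y : H) e : set (H -> H) :=
  [set T | ball_ops r T /\ exists n, nrm (iter n T x - y) < e].

(** Closeness of [S] to [T] on the orbit segment [x, ..., T^(n-1) x] controls [S^n x], because the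
    bound [r] on [S] limits how errors grow. *)
Lemma approach_set_open r x y e : 0 <= r ->
  sot_open_in (ball_ops r) (approach_set r x y e).
Proof.
move=> r0; apply/sot_openP; split=> [T []//|T [_ [n hn]]].
(* An error [d * K k] at step [k] becomes at most [r] times itself plus a fresh [d], whence this
   recursion. *)
pose K k := iter k (fun K => r * K + 1) 0.
have K0 k : 0 <= K k.
  by elim: k => //= k IH; rewrite addr_ge0 // mulr_ge0.
pose d := (e - nrm (iter n T x - y)) / (K n + 1).
have K1 : 0 < K n + 1 by rewrite ltr_wpDl.
have d0 : 0 < d by rewrite divr_gt0 // subr_gt0.
exists [seq iter k T x | k <- iota 0 n], d; split => //.
move=> S BS hS; split => //; exists n.
have /ball_opsP[lS nS] := BS.
have hk k : (k <= n)%N -> nrm (iter k S x - iter k T x) <= d * K k.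
  elim: k => [|k IH] kn; first by rewrite /= subrr nrm0 mulr0.
  apply: le_trans (nrm_dist_triangle (S (iter k T x)) _ _) _.
  rewrite /= -linear_opB // mulrDr mulr1 lerD //.
    by rewrite (le_trans (nS _)) // mulrCA ler_wpM2l // IH // ltnW.
  by apply/ltW/hS; apply: map_f; rewrite mem_iota.
apply: le_lt_trans (nrm_dist_triangle (iter n T x) _ _) _.
have : d * (K n + 1) = e - nrm (iter n T x - y) by rewrite /d divfK // gt_eqF.
have := hk n (leqnn n); lra.
Qed.

Lemma approach_set_dense (ip : H -> H -> R[i]) r x y e U :
  is_inner_product ip -> infinite_dimensional H ->
  1 < r -> x <> 0 -> 0 < e ->
  sot_open_in (ball_ops r) U -> U !=set0 -> U `&` approach_set r x y e !=set0.
Proof.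
move=> Hip Hinf r1 x0 e0 [UB hU] [T UT].
have [n [xs [d [d0 hd]]]] := hU _ UT.
have [S [BS SxT Sy]] := exists_close_operator Hip Hinf xs y r1 (UB _ UT) x0 d0 e0.
by exists S; split; [apply: hd => // i; rewrite nrm_lt|].
Qed.

(** The inequalities are non-strict so that they survive pointwise limits. *)
Definition sot_cball B T l e : set (H -> H) :=
  [set S | B S /\ forall v, v \in l -> nrm (S v - T v) <= e].

Lemma sot_open_cball B U T : sot_open_in B U -> U T ->
  exists l e, 0 < e /\ sot_cball B T l e `<=` U.
Proof.
move=> /sot_openP[_ hU] /hU[l [e [e0 h]]].
exists l, (e / 2); split; first by lra.
move=> S [BS hS]; apply: h => // v /hS; lra.
Qed.

(** One step of the nested-ball construction: entering [U], it also adds [x] to the controlled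
    vectors and brings the radius below [eta], which later forces convergence of the centres. *)
Lemma sot_baire_step B U (x : H) (eta : R) T l e :
  sot_open_in B U ->
  (forall V, sot_open_in B V -> V !=set0 -> V `&` U !=set0) ->
  0 < eta -> B T -> 0 < e ->
  exists T' l' e', [/\ B T' /\ 0 < e', e' <= eta, x \in l',
    {subset l <= l'} & sot_cball B T' l' e' `<=` U `&` sot_cball B T l e].
Proof.
move=> oU dU eta0 BT e0.
have [|T' [[BT' T'T] UT']] := dU _ (sot_open_basic B T l e).
  by exists T; split => // v _; rewrite subrr nrm0.
have oI := sot_openI oU (sot_open_basic B T l e).
have [|l' [e' [e'0 h]]] := @sot_open_cball _ _ T' oI; first by [].
exists T', (x :: l ++ l'), (Num.min e' eta); split.
- by rewrite lt_min e'0.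
- by rewrite ge_min lexx orbT.
- by rewrite inE eqxx.
- by move=> v vl; rewrite inE mem_cat vl orbT.
- move=> S [BS hS]; have [|US [_ hl]] := h S.
    split => // v vl; have := hS v.
    by rewrite inE mem_cat vl !orbT le_min => /(_ isT)/andP[].
  by split => //; split => // v /hl/ltW.
Qed.

End StrongOperatorTopology.

(** * The Baire property of the ball of operators *)

Section Baire.
Context {R : realType} {H : completeNormedModType R[i]}.

Lemma sot_pointwise_limit (r : R) (T : nat -> H -> H) (L : H -> H) :
  (forall n, ball_ops r (T n)) -> (forall v, nrm_cvg (fun n => T n v) (L v)) ->
  ball_ops r L.
Proof.
move=> BT TL; apply/ball_opsP; split=> [a u v|v]; last first.
  apply/ler_addgt0Pr => e e0; have [N /(_ N (leqnn N))] := TL v e e0.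
  have /ball_opsP[_ /(_ v)] := BT N.
  have := nrm_triangle (L v - T N v) (T N v).
  by rewrite subrK nrm_sub; lra.
apply/eqP; rewrite -subr_eq0; apply/eqP/nrm_le_eps => e e0.
have a1 : 0 < nrm a + 1 by have := nrm_ge0 a; lra.
have e30 : 0 < e / 3 by lra.
have [N1 h1] := TL (a *: u + v) _ e30.
(* The [+ 1] covers the case [a = 0]. *)
have ea : 0 < e / 3 / (nrm a + 1) by rewrite divr_gt0.
have [N2 h2] := TL u _ ea; have [N3 h3] := TL v _ e30.
pose N := maxn N1 (maxn N2 N3).
have {}h1 := h1 N (leq_maxl _ _).
have {}h2 := h2 N (leq_trans (leq_maxl _ _) (leq_maxr _ _)).
have {}h3 := h3 N (leq_trans (leq_maxr _ _) (leq_maxr _ _)).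
have -> : L (a *: u + v) - (a *: L u + L v) =
    (L (a *: u + v) - T N (a *: u + v))
    + (a *: (T N u - L u) + (T N v - L v)).
  have /ball_opsP[lT _] := BT N.
  by rewrite scalerBr lT (addrACA (a *: T N u)) -opprD addrA subrK.
apply: (le_trans (nrm_triangle _ _)); rewrite nrm_sub.
have := nrm_triangle (a *: (T N u - L u)) (T N v - L v); rewrite nrmZ.
have : nrm a * nrm (T N u - L u) <= e / 3.
  apply: (@le_trans _ _ ((nrm a + 1) * nrm (T N u - L u))).
    by rewrite ler_wpM2r ?nrm_ge0 //; lra.
  by rewrite mulrC -ler_pdivlMr // ltW.
by lra.
Qed.

(** Nested closed balls with radii tending to 0 eventually control every [d j], so their centres are
    Cauchy on a dense set. The common bound [r] extends this to all of [H], and the pointwise limit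
    lies in every ball. *)
Lemma sot_baire (r : R) (d : nat -> H) (U : nat -> set (H -> H))
    (V : set (H -> H)) :
  0 <= r -> dense (range d) ->
  (forall k, sot_open_in (ball_ops r) (U k)) ->
  (forall k W, sot_open_in (ball_ops r) W -> W !=set0 -> W `&` U k !=set0) ->
  sot_open_in (ball_ops r) V -> V !=set0 ->
  V `&` \bigcap_k U k !=set0.
Proof.
set B := ball_ops r => r0 /dense_nrm dd oU dU oV [T0 VT0].
have [l0 [e0 [e0_gt0 V0]]] := sot_open_cball oV VT0.
have BT0 : B T0 by case: oV => + _; apply.
(* A state is a centre, a list of controlled vectors and a radius. *)
pose state : Type := ((H -> H) * seq H * R)%type.
pose good (s : state) := B s.1.1 /\ 0 < s.2.
pose C (s : state) := sot_cball B s.1.1 s.1.2 s.2.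
have /choice[F hF] : forall ks : nat * state, exists s' : state, good ks.2 ->
    [/\ good s', s'.2 <= (ks.1.+1%:R)^-1, d ks.1 \in s'.1.2,
        {subset ks.2.1.2 <= s'.1.2} & C s' `<=` U ks.1 `&` C ks.2].
  (* [choice] asks for a successor of every state; one that is not good is sent to itself and never
     occurs in the run. *)
  move=> [k s]; have [gs|ngs] := pselect (good s); last by exists s.
  have eta0 : 0 < (k.+1%:R)^-1 :> R by rewrite invr_gt0.
  have [T' [l' [e' h]]] := sot_baire_step (d k) s.1.2 (oU k) (dU k) eta0 gs.1 gs.2.
  by exists (T', l', e').
pose st := fix st k : state :=
  if k is j.+1 then F (j, st j) else (T0, l0, e0).
have gst k : good (st k) by elim: k => // k IH; have [] := hF (k, st k) IH.
have hst k := hF (k, st k) (gst k).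
pose T k := (st k).1.1.
have CT m n : (m <= n)%N -> C (st n) `<=` C (st m).
  elim: n => [|n IH]; first by rewrite leqn0 => /eqP ->.
  rewrite leq_eqVlt => /orP[/eqP -> //|/IH mn] S CS; apply: mn.
  by have [_ _ _ _ /(_ S CS)[]] := hst n.
have TC m n : (m <= n)%N -> C (st m) (T n).
  move=> mn; apply: (CT _ _ mn); have [Bn en] := gst n; split => // v _.
  by rewrite subrr nrm0 ltW.
have BT n : B (T n) by have [] := gst n.
have dl j k : (j < k)%N -> d j \in (st k).1.2.
  elim: k => // k IH; rewrite ltnS leq_eqVlt => /orP[/eqP ->|/IH h].
    by have [_ _ ] := hst k.
  by have [_ _ _ /(_ _ h)] := hst k.
have /choice[L hL] : forall v, exists l, nrm_cvg (fun n => T n v) l.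
  move=> v; apply: nrm_cauchy_cvg => e e_gt0.
  have r1 : 0 < 4 * (r + 1) by lra.
  (* Replacing [v] by [d j] costs at most [e / 4] for each of [T m] and [T n], and both are within
     [e / 4] of the centre [T K.+1] at [d j]. The [r + 1] avoids division by zero. *)
  have [_ [j _ <-] dv] := dd v (e / (4 * (r + 1))) (divr_gt0 e_gt0 r1).
  have e4 : 0 < e / 4 by lra.
  have [k _ /(_ k (leqnn k)) /= hk] := near_infty_natSinv_lt (PosNum e4).
  pose K := maxn j k.
  have dK : d j \in (st K.+1).1.2 by apply: dl; rewrite ltnS leq_maxl.
  have eK : (st K.+1).2 < e / 4.
    have [_ hK _ _ _] := hst K; apply: le_lt_trans hK _; apply: le_lt_trans hk.
    by rewrite /= lef_pV2 ?posrE // ler_nat ltnS leq_maxr.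
  have rdv : r * nrm (d j - v) <= e / 4.
    apply: (@le_trans _ _ ((r + 1) * nrm (d j - v))).
      by rewrite ler_wpM2r ?nrm_ge0 //; lra.
    move: dv; rewrite ltr_pdivlMr //; lra.
  exists K.+1 => m n mK nK.
  have hm : nrm (T m (d j) - T K.+1 (d j)) <= (st K.+1).2 by apply: (TC _ _ mK).2.
  have hn : nrm (T n (d j) - T K.+1 (d j)) <= (st K.+1).2 by apply: (TC _ _ nK).2.
  have := nrm_dist_triangle (T m (d j)) (T m v) (T n v).
  have := nrm_dist_triangle (T n (d j)) (T m (d j)) (T n v).
  have := nrm_dist_triangle (T K.+1 (d j)) (T m (d j)) (T n (d j)).
  rewrite (nrm_sub (T m v) (T m (d j))) (nrm_sub (T K.+1 (d j)) (T n (d j))).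
  have /ball_opsP[lm /(_ (d j - v))] := BT m; rewrite linear_opB //.
  have /ball_opsP[ln /(_ (d j - v))] := BT n; rewrite linear_opB //.
  by lra.
have BL : B L := sot_pointwise_limit BT hL.
have LC k : C (st k) L.
  split => // v vl; apply/ler_addgt0Pr => e e_gt0.
  have [N hN] := hL v e e_gt0; have {hN} := hN (maxn N k) (leq_maxl _ _).
  have := (TC k (maxn N k) (leq_maxr _ _)).2 v vl.
  have := nrm_dist_triangle (T (maxn N k) v) (L v) ((st k).1.1 v).
  by rewrite (nrm_sub (L v) (T (maxn N k) v)); lra.
exists L; split; first exact: V0 (LC 0%N).
by move=> k _; have [_ _ _ _ /(_ L (LC k.+1))[]] := hst k.
Qed.

End Baire.

(** * The countable intersection and the conclusion *)

(** Density of an orbit need only be tested at the points [d j] with tolerances [1/(m+1)]. Triples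
    are coded as naturals to give a sequence of sets; a number that codes nothing repeats the set of
    [(0, 0, 0)]. *)
Lemma L_HC_bigcap (R : realType) (H : normedModType R[i]) (r : R)
    (d : nat -> H) :
  dense (range d) ->
  L_HC r (range d) = \bigcap_k
    let: (i, j, m) := odflt (0, 0, 0)%N (unpickle k : option (nat * nat * nat)) in
    approach_set r (d i) (d j) (m.+1%:R)^-1.
Proof.
move=> /dense_nrm dd; apply/seteqP; split=> T.
  move=> [BT hT] k _; case: (odflt _ _) => -[i j] m; split => //.
  have /dense_nrm/(_ (d j) (m.+1%:R)^-1) := hT (d i) (imageT _ _).
  case; first by rewrite invr_gt0.
  by move=> _ [n _ <-] h; exists n.
move=> hT.
have {}hT i j m : approach_set r (d i) (d j) (m.+1%:R)^-1 T.
  by have := hT (pickle (i, j, m)) I; rewrite pickleK.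
split; first by have [] := hT 0%N 0%N 0%N.
move=> _ [i _ <-]; apply/dense_nrm => y e e0.
have e2 : 0 < e / 2 by lra.
have [_ [j _ <-] dy] := dd y (e / 2) e2.
have [m _ /(_ m (leqnn m)) /= hm] := near_infty_natSinv_lt (PosNum e2).
have [_ [n hn]] := hT i j m.
exists (iter n T (d i)); first by exists n.
apply: le_lt_trans (nrm_dist_triangle (d j) _ _) _.
by have := lt_trans hn hm; move: dy => /=; lra.
Qed.

Theorem theorem1 (R : realType) (H : completeNormedModType R[i])
    (ip : H -> H -> R[i]) (Hip : is_inner_product ip)
    (Hsep : separable H) (Hinf : infinite_dimensional H)
    (D : set H) (HDc : countable D) (HDd : dense D) (HD0 : D `<=` ~` [set 0])
    (r : R) (Hr : 1 < r) :
  sot_Gdelta_in (ball_ops r) (L_HC r D) /\ sot_dense_in (ball_ops r) (L_HC r D).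
Proof.
have r0 : 0 <= r by lra.
have [d Dd] : exists d : nat -> H, D = range d.
  (* A countable set is empty or the range of a sequence, and a dense set is not empty. *)
  move: HDc => /pfcard_geP[D0|/surjfunPex//].
  have [x []] := HDd setT (ex_intro _ 0 I) openT.
  by rewrite D0.
subst D; rewrite L_HC_bigcap //.
have openU k : sot_open_in (ball_ops r)
    (let: (i, j, m) := odflt (0, 0, 0)%N (unpickle k : option (nat * nat * nat)) in
     approach_set r (d i) (d j) (m.+1%:R)^-1).
  by case: (odflt _ _) => -[i j] m; exact: approach_set_open.
split; first by eexists; split; [exact: openU|].
split; first by move=> T /(_ 0%N I); exact: (openU 0%N).1.
move=> V oV V0; apply: (sot_baire r0 HDd) => // k W oW W0.
case: (odflt _ _) => -[i j] m; apply: (approach_set_dense _ Hip Hinf) => //.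
exact: (HD0 (d i) (imageT _ _)).
Qed.
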